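(* Let $k$ be a field, $n \ge 4$, and let $\Delta$ be a pure $(n-3)$-dimensional simplicial complex on the $n$ vertices $\{1,\dots,n\}$ such that no vertex belongs to all facets of $\Delta$. Then the vertex cover algebra $A(\Delta)$ is a standard graded algebra over $S = k[x_1,\dots,x_n]$ if and only if $n = 4$ and $\Delta$ is a path or a cycle of length $4$ or the union of two disjoint edges.
   Context: $\Delta$ pure of dimension $n-3$ means that all facets of $\Delta$ have exactly $n-2$ elements; for $n=4$, $\Delta$ is thus identified with the graph whose edges are its facets (paths and cycles pass through all 4 vertices). For an integer $m \ge 0$, a vector $\mathbf{c} = (c_1,\dots,c_n) \in \mathbb{N}^n$ (with $0 \in \mathbb{N}$) is an $m$-cover of $\Delta$ if $\sum_{i\in F} c_i \ge m$ for all facets $F$ of $\Delta$. Let $A_m(\Delta)$ be the $k$-vector space generated by all monomials $x^{\mathbf{c}} t^m = x_1^{c_1}\cdots x_n^{c_n} t^m$ with $\mathbf{c}$ an $m$-cover of $\Delta$, where $t$ is a new variable. The vertex cover algebra of $\Delta$ is the graded $S$-algebra $A(\Delta) = \bigoplus_{m\ge 0} A_m(\Delta) \subseteq S[t]$, with $A_0(\Delta) = S$. It is standard graded if it is generated over $S$ by its forms of degree 1, i.e. by $A_1(\Delta)$. *)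

(* Defs.v *)
From HB Require Import structures.
From mathcomp Require Export all_boot all_order all_algebra.
From mathcomp Require Export ssrcomplements freeg mpoly.

Set Implicit Arguments.
Unset Strict Implicit.
Unset Printing Implicit Defensive.

Import GRing.Theory.
Local Open Scope ring_scope.

Section Complexes.
Variable n : nat.
Implicit Types D : {set {set 'I_n}}.

(* A simplicial complex whose vertices are exactly the elements of 'I_n,
   which stands for {1,...,n}: every singleton is required to be a face. *)
Definition simplicial_complex D : Prop :=
  (forall i : 'I_n, [set i] \in D) /\
  (forall F G : {set 'I_n}, F \in D -> G \subset F -> G \in D).

Definition facets D : {set {set 'I_n}} :=
  [set F | maxset (fun G : {set 'I_n} => G \in D) F].

(* A face of dimension d has d + 1 elements. *)
Definition pure_of_dim D (d : nat) : Prop :=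
  forall F : {set 'I_n}, F \in facets D -> #|F| = d.+1.

(* The next three shapes are used for n = 4 only; there, uniqueness forces
   a, b, c, d to exhaust the vertex set, so all of them are spanning. *)
Definition is_path4 D : Prop :=
  exists a b c d : 'I_n, uniq [:: a; b; c; d] /\
    facets D = [set [set a; b]; [set b; c]; [set c; d]].

Definition is_cycle4 D : Prop :=
  exists a b c d : 'I_n, uniq [:: a; b; c; d] /\
    facets D = [set [set a; b]; [set b; c]; [set c; d]; [set d; a]].

Definition is_two_disjoint_edges D : Prop :=
  exists a b c d : 'I_n, uniq [:: a; b; c; d] /\
    facets D = [set [set a; b]; [set c; d]].

(* Exponent vectors in N^n are the multinomials of type 'X_{1..n}. *)
Definition is_cover D (m : nat) (c : 'X_{1..n}) : Prop :=
  forall F : {set 'I_n}, F \in facets D -> (m <= \sum_(i in F) c i)%N.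

End Complexes.

(* The R-subalgebra of A generated by a subset G of A. *)
Inductive alg_gen (R : comNzRingType) (A : algType R) (G : A -> Prop) :
    A -> Prop :=
  | alg_gen_mem x : G x -> alg_gen G x
  | alg_gen_scalar (a : R) : alg_gen G a%:A
  | alg_gen_add x y : alg_gen G x -> alg_gen G y -> alg_gen G (x + y)
  | alg_gen_mul x y : alg_gen G x -> alg_gen G y -> alg_gen G (x * y).

Section VertexCoverAlgebra.
Variables (k : fieldType) (n : nat).
Implicit Types D : {set {set 'I_n}}.

(* S[t] is {poly {mpoly k[n]}}, where t is 'X; the monomial x^c t^m is
   'X_[c] *: 'X^m.  Scalars of k act on coefficients, because S[t] is
   canonically a module over S and not over k. *)
Definition vertex_cover_comp D (m : nat) (f : {poly {mpoly k[n]}}) : Prop :=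
  exists r : seq (k * 'X_{1..n}),
    (forall u, u \in r -> is_cover D m u.2) /\
    f = \sum_(u <- r) (u.1 *: 'X_[u.2]) *: 'X^m.

(* The sum over all m of the components; it is direct since distinct
   components lie in distinct t-degrees. *)
Definition vertex_cover_algebra D (f : {poly {mpoly k[n]}}) : Prop :=
  exists (N : nat) (g : nat -> {poly {mpoly k[n]}}),
    (forall m, vertex_cover_comp D m (g m)) /\ f = \sum_(m < N) g m.

Definition vertex_cover_standard_graded D : Prop :=
  forall f : {poly {mpoly k[n]}},
    vertex_cover_algebra D f <-> alg_gen (vertex_cover_comp D 1) f.

End VertexCoverAlgebra.
Arguments vertex_cover_standard_graded k {n} D.

(* Main.v *)
Require Import Defs.
From mathcomp Require Import all_boot all_order all_algebra.
From mathcomp Require Import zify.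

(** Everything reduces to exponent vectors.  [A(D)] is spanned over [k] by the
    monomials [x^c t^m] with [c] an [m]-cover, and the subalgebra generated by
    its degree one part is spanned by those for which [c] dominates a sum of
    [m] covers of order 1; hence [A(D)] is standard graded exactly when every
    [m]-cover splits in this way ([standard_gradedP]).

    A single vector then rules out all but finitely many complexes.  Facets
    have [n - 2] elements, so the all-ones vector is an [(n - 2)]-cover.  As no
    vertex lies in all facets, a 1-cover has total weight at least 2
    ([cover1_weight]), so a splitting of the all-ones vector costs at least
    [2 (n - 2)] out of a total weight [n], which forces [n <= 4].  For [n = 4]
    the splitting is tight: it partitions the vertices into two pairs that both
    meet every edge, so [D] is a subgraph of a 4-cycle without isolated
    vertices ([two_colored_four_vertices]), that is, one of the three listed
    graphs.

    Conversely those graphs are bipartite, and for a bipartite graph a 1-cover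
    can be subtracted greedily from an [(m + 1)]-cover: take weight 1 wherever
    possible on one side, but on the other side only at vertices that reach
    [m + 1] by themselves ([bipartite_splits]). *)

Set Implicit Arguments.
Unset Strict Implicit.
Unset Printing Implicit Defensive.

Import GRing.Theory.
Local Open Scope ring_scope.

(** * Monomial subalgebras of S[t] *)

Section Supported.
Variables (k : fieldType) (n : nat).
Implicit Types (P : nat -> 'X_{1..n} -> Prop) (f g : {poly {mpoly k[n]}}).

Definition supported P f : Prop :=
  forall m c, c \in msupp f`_m -> P m c.

Lemma supported0 P : supported P 0.
Proof. by move=> m c; rewrite coef0 msupp0. Qed.

Lemma supportedD P f g : supported P f -> supported P g -> supported P (f + g).
Proof.
move=> Pf Pg m c; rewrite coefD => /msuppD_le; rewrite mem_cat.
by case/orP; [apply: Pf | apply: Pg].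
Qed.

Lemma supported_sum (I : eqType) (r : seq I) P (F : I -> {poly {mpoly k[n]}}) :
  (forall i, i \in r -> supported P (F i)) -> supported P (\sum_(i <- r) F i).
Proof.
move=> PF; rewrite big_seq.
by apply: big_ind => //; [exact: supported0 | move=> *; exact: supportedD].
Qed.

Lemma supported_monomial P (a : k) c m :
  P m c -> supported P ((a *: 'X_[c]) *: 'X^m).
Proof.
move=> Pmc m' c'; rewrite coefZ coefXn.
case: eqP => [->|_]; last by rewrite mulr0 msupp0.
by rewrite mulr1 => /msuppZ_le; rewrite msuppX inE => /eqP->.
Qed.

Lemma msupp_sum_sub (I : Type) (r : seq I) (F : I -> {mpoly k[n]}) c :
  c \in msupp (\sum_(i <- r) F i) -> exists i, c \in msupp (F i).
Proof.
elim: r => [|i r IHr]; first by rewrite big_nil msupp0.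
rewrite big_cons => /msuppD_le; rewrite mem_cat => /orP[ci|/IHr//].
by exists i.
Qed.

Lemma supportedM P f g :
    (forall m m' c c', P m c -> P m' c' -> P (m + m')%N (c + c')%MM) ->
  supported P f -> supported P g -> supported P (f * g).
Proof.
move=> PM Pf Pg m c; rewrite coefM => /msupp_sum_sub[i] /msuppM_le.
case/allpairsP=> -[c1 c2] /= [c1f c2g ->].
by rewrite -[m](@subnKC i) ?leq_ord //; apply: PM; [exact: Pf | exact: Pg].
Qed.

(** Products of monomials are monomials, so a set of exponents that is closed
    under addition and contains all those of t-degree 0 spans a subalgebra
    over the coefficient ring. *)
Lemma alg_gen_supported P (G : {poly {mpoly k[n]}} -> Prop) f :
    (forall c, P 0%N c) ->
    (forall m m' c c', P m c -> P m' c' -> P (m + m')%N (c + c')%MM) ->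
    (forall g, G g -> supported P g) ->
  alg_gen G f -> supported P f.
Proof.
move=> P0 PM PG; elim=> [g /PG//|a m c|g h _ Pg _ Ph|g h _ Pg _ Ph].
- rewrite coefZ coef1; case: m => [|m] /=; first by move=> _; apply: P0.
  by rewrite mulr0 msupp0.
- exact: supportedD.
- exact: supportedM.
Qed.

Lemma poly_monomialE f :
  f = \sum_(m < size f) \sum_(c <- msupp f`_m) (f`_m@_c *: 'X_[c]) *: 'X^m.
Proof.
rewrite -[LHS]coefK poly_def; apply: eq_bigr => m _.
by rewrite {1}[f`_m]mpolyE scaler_suml.
Qed.

End Supported.

(** * Vertex cover algebras through exponent vectors *)

Section Splitting.
Variables (k : fieldType) (n : nat) (D : {set {set 'I_n}}).
Implicit Types (b c : 'X_{1..n}) (f : {poly {mpoly k[n]}}).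

(** The summand [c0] is the contribution of the coefficient ring. *)
Definition splits (m : nat) c : Prop :=
  exists c0 (s : seq 'X_{1..n}),
    [/\ size s = m, forall b, b \in s -> is_cover D 1 b &
        c = (c0 + \sum_(b <- s) b)%MM].

Lemma is_coverD m m' c c' :
  is_cover D m c -> is_cover D m' c' -> is_cover D (m + m') (c + c')%MM.
Proof.
move=> Cc Cc' F FD; under eq_bigr do rewrite mnmDE.
by rewrite big_split leq_add ?Cc ?Cc'.
Qed.

Lemma splits0 c : splits 0 c.
Proof. by exists c, [::]; split=> //; rewrite big_nil addm0. Qed.

Lemma splitsD m m' c c' :
  splits m c -> splits m' c' -> splits (m + m') (c + c')%MM.
Proof.
move=> [c0 [s [<- Cs ->]]] [c0' [s' [<- Cs' ->]]].
exists (c0 + c0')%MM, (s ++ s'); split.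
- by rewrite size_cat.
- by move=> b; rewrite mem_cat => /orP[/Cs|/Cs'].
- by rewrite big_cat /= Monoid.mulmACA.
Qed.

Lemma splits1 c : is_cover D 1 c -> splits 1 c.
Proof.
move=> Cc; exists 0%MM, [:: c]; split=> //; last by rewrite big_seq1 add0m.
by move=> b; rewrite inE => /eqP->.
Qed.

Lemma splits_cover m c : splits m c -> is_cover D m c.
Proof.
move=> [c0 [s [<- Cs ->]]]; rewrite -[size s]add0n.
apply: is_coverD => //; elim: s Cs => [|b s IHs] Cs //=.
rewrite big_cons -add1n; apply: is_coverD; first by apply: Cs; rewrite mem_head.
by apply: IHs => b' b's; apply: Cs; rewrite inE b's orbT.
Qed.

Lemma vertex_cover_comp_supported m f :
  vertex_cover_comp D m f -> supported (fun m' c => m' = m /\ is_cover D m c) f.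
Proof.
by move=> [r [Cr ->]]; apply: supported_sum => u /Cr Cu;
  apply: supported_monomial.
Qed.

Lemma vertex_cover_comp_monomial m c :
  is_cover D m c ->
  vertex_cover_comp D m ('X_[c] *: 'X^m : {poly {mpoly k[n]}}).
Proof.
move=> Cc; exists [:: (1, c)]; split; first by move=> u; rewrite inE => /eqP->.
by rewrite big_seq1 scale1r.
Qed.

Lemma vertex_cover_algebraP f :
  vertex_cover_algebra D f <-> supported (is_cover D) f.
Proof.
split=> [[N [g [Cg ->]]]|Cf].
  apply: supported_sum => i _ m c cg.
  by have [->] := vertex_cover_comp_supported (Cg i) cg.
exists (size f), (fun m => \sum_(c <- msupp f`_m) (f`_m@_c *: 'X_[c]) *: 'X^m).
split; last exact: poly_monomialE.
move=> m; exists [seq (f`_m@_c, c) | c <- msupp f`_m].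
split; last by rewrite [RHS]big_map.
by move=> _ /mapP[c cf ->]; apply: Cf.
Qed.

(** Splittings are closed under addition, which bounds the generated algebra;
    conversely a splitting of [c] factors [x^c t^m] into [m] generators. *)
Lemma alg_gen_cover1P f :
  alg_gen (vertex_cover_comp D 1) f <-> supported splits f.
Proof.
split.
  apply: alg_gen_supported; [exact: splits0 | exact: splitsD |].
  move=> g /vertex_cover_comp_supported Cg m c /Cg[-> ]; exact: splits1.
move=> Sf.
have gen0 : alg_gen (vertex_cover_comp D 1) (0 : {poly {mpoly k[n]}}).
  by rewrite -[0](scale0r 1); apply: alg_gen_scalar.
rewrite [f]poly_monomialE; apply: big_ind => [//|g h|m _].
  exact: alg_gen_add.
rewrite big_seq; apply: big_ind => [//|g h|c /Sf[c0 [s [<- Cs ->]]]].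
  exact: alg_gen_add.
move: (_@_ _) => a.
(* The extra summand c0 goes into a scalar, each 1-cover into a generator. *)
have -> : (a *: 'X_[c0 + \sum_(b <- s) b]) *: 'X^(size s) =
    (a *: 'X_[c0])%:A * \prod_(b <- s) ('X_[b] *: 'X^1) :> {poly {mpoly k[n]}}.
  rewrite mulr_algl mpolyXD scalerAl -scalerA; congr (_ *: _).
  elim: (s) => [|b s' IHs]; first by rewrite !big_nil mpolyX0 scale1r expr0.
  by rewrite !big_cons -IHs mpolyXD /= -add1n exprD -scalerAl -scalerAr scalerA.
apply: alg_gen_mul; first exact: alg_gen_scalar.
rewrite big_seq; apply: big_ind => [|g h|b bs].
- by rewrite -[1]scale1r; apply: alg_gen_scalar.
- exact: alg_gen_mul.
- by apply: alg_gen_mem; apply: vertex_cover_comp_monomial; apply: Cs.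
Qed.

Lemma standard_gradedP :
  vertex_cover_standard_graded k D <->
  forall m c, is_cover D m c -> splits m c.
Proof.
split=> [std m c Cc|split_cover f].
  have : vertex_cover_algebra D ('X_[c] *: 'X^m : {poly {mpoly k[n]}}).
    apply/vertex_cover_algebraP; rewrite -['X_[c]]scale1r.
    exact: supported_monomial.
  move/std/alg_gen_cover1P; apply.
  by rewrite coefZ coefXn eqxx mulr1 msuppX mem_seq1.
rewrite vertex_cover_algebraP alg_gen_cover1P.
by split=> Sf m c /Sf; [exact: split_cover | exact: splits_cover].
Qed.

End Splitting.

(** * Bipartite graphs *)

Local Close Scope ring_scope.
Local Open Scope nat_scope.

Definition bicolored n (D : {set {set 'I_n}}) (U : {set 'I_n}) : Prop :=
  forall F, F \in facets D ->
    exists u v, [/\ u \in U, v \notin U & F = [set u; v]].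

(** Induction on the order: it suffices to subtract one 1-cover so that an
    [m]-cover remains. *)
Lemma bipartite_splits n (D : {set {set 'I_n}}) (U : {set 'I_n}) :
    bicolored D U ->
  forall m c, is_cover D m c -> splits D m c.
Proof.
move=> bip; have sumF (u v : 'I_n) (c : 'X_{1..n}) : u \in U -> v \notin U ->
    (\sum_(i in [set u; v]) c i = c u + c v).
  move=> uU vU; rewrite big_setU1 ?big_set1 // inE.
  by apply: contraNneq vU => <-.
elim=> [|m IHm] c Cc; first exact: splits0.
(* An edge uv can lose 2 only if c u > 0 and c v > m, so its weight stays at
   least m; it loses 0 only if c u = 0 and c v <= m, which Cc excludes. *)
pose b := [multinom (if i \in U then 0 < c i else m < c i) : nat | i < n].
have bc : (b <= c)%MM.
  by apply/mnm_lepP => i; rewrite mnmE; case: ifP => _; case: ltnP => //; lia.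
have Cb : is_cover D 1 b.
  move=> F FD; have := Cc F FD; have [u [v [uU vU ->]]] := bip F FD.
  by rewrite !sumF // !mnmE uU (negPf vU); lia.
have /IHm Sc : is_cover D m (c - b)%MM.
  move=> F FD; have := Cc F FD; have [u [v [uU vU ->]]] := bip F FD.
  by rewrite !sumF // !mnmBE !mnmE uU (negPf vU); lia.
rewrite -(submK bc) addmC -[m.+1]add1n; apply: splitsD => //.
exact: splits1.
Qed.

Lemma sub_cycle4_splits n (D : {set {set 'I_n}}) (a b c d : 'I_n) :
    uniq [:: a; b; c; d] ->
    (forall F, F \in facets D ->
       F \in [:: [set a; b]; [set b; c]; [set c; d]; [set d; a]]) ->
  forall m e, is_cover D m e -> splits D m e.
Proof.
move=> uniq4 sub; apply: (bipartite_splits (U := [set a; c])) => F /sub.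
move: uniq4; rewrite /= !inE !negb_or.
move=> /and4P[/and3P[ab _ ad] /andP[bc _] cd _].
have [bU dU] : b \notin [set a; c] /\ d \notin [set a; c].
  by rewrite !in_set2 !negb_or ![_ == a]eq_sym [d == c]eq_sym ab bc ad cd.
have [aU cU] : a \in [set a; c] /\ c \in [set a; c].
  by rewrite !in_set2 !eqxx orbT.
by case/or4P=> /eqP->; [exists a, b | exists c, b | exists c, d | exists a, d];
  split=> //; exact: setUC.
Qed.

(** * Splitting the all-ones vector *)

Section AllOnes.
Variables (n : nat) (D : {set {set 'I_n}}).
Hypothesis hD : simplicial_complex D.

Lemma vertex_in_facet (i : 'I_n) : exists2 F, F \in facets D & i \in F.
Proof.
have [F maxF iF] := maxset_exists (P := fun G => G \in D) (hD.1 i).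
by exists F; rewrite ?inE // -sub1set.
Qed.

(** Some vertex [j] has positive weight, and a facet that avoids [j] demands
    another unit of weight elsewhere. *)
Lemma cover1_weight (b : 'X_{1..n}) :
    0 < n ->
    ~ (exists i : 'I_n, forall F : {set 'I_n}, F \in facets D -> i \in F) ->
  is_cover D 1 b -> 2 <= mdeg b.
Proof.
move=> n_gt0 hcone Cb.
have [F FD _] := vertex_in_facet (Ordinal n_gt0).
have [j bj] : exists j, 0 < b j.
  apply/existsP; have := Cb F FD; apply: contraTT; rewrite negb_exists.
  move=> /forallP b0; rewrite -leqNgt leqn0 sum_nat_eq0.
  by apply/forall_inP => i _; have := b0 i; lia.
have [G GD jG] : exists2 G, G \in facets D & j \notin G.
  apply/exists_inP; apply: contra_notT hcone => /exists_inPn hj.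
  by exists j => G /hj; rewrite negbK.
rewrite mdegE (bigID (mem G)) /= -addn1 leq_add ?Cb //.
by rewrite (bigD1 j) //= addn_gt0 bj.
Qed.

Lemma all_ones_cover m :
    (forall F, F \in facets D -> #|F| = m) ->
  is_cover D m [multinom 1 | _ < n].
Proof.
move=> cardF F FD; under eq_bigr do rewrite mnmE.
by rewrite sum1_card cardF.
Qed.

Lemma split_weight m c (s : seq 'X_{1..n}) :
    (forall b, b \in s -> m <= mdeg b) ->
  size s * m <= mdeg (c + \sum_(b <- s) b)%MM.
Proof.
move=> ms; rewrite mdegD mdeg_sum; apply: leq_trans (leq_addl _ _).
rewrite -[size s]count_predT -sum1_count big_distrl /= big_seq [leqRHS]big_seq.
by apply: leq_sum => b /ms; rewrite mul1n.
Qed.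

Lemma mdeg_all_ones : mdeg [multinom 1 | _ < n] = n.
Proof.
by rewrite mdegE; under eq_bigr do rewrite mnmE; rewrite sum1_card card_ord.
Qed.

End AllOnes.

(** * Four vertices *)

(** The two colour classes [U] and [~: U] span a complete bipartite graph, which
    is the 4-cycle a b c d with [U = {a, c}]; that no vertex is isolated then
    means that no two consecutive edges of this cycle are both missing. *)
Lemma two_colored_four_vertices n (D : {set {set 'I_n}}) (U : {set 'I_n}) :
    simplicial_complex D ->
    bicolored D U ->
    #|U| = 2 -> #|~: U| = 2 ->
  is_path4 D \/ is_cycle4 D \/ is_two_disjoint_edges D.
Proof.
move=> hD bip /eqP/cards2P[a [c [ac Uac]]] /eqP/cards2P[b [d [bd Ubd]]].
have inU x : (x \in U) = (x == a) || (x == c) by rewrite Uac !inE.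
have ninU x : (x \notin U) = (x == b) || (x == d).
  by rewrite -in_setC Ubd !inE.
have diff x y : x \in U -> y \notin U -> x != y.
  by move=> xU; apply: contraNneq => <-.
have [aU cU] : a \in U /\ c \in U by rewrite !inU !eqxx orbT.
have [bU dU] : b \notin U /\ d \notin U by rewrite !ninU !eqxx orbT.
have uniq4 : uniq [:: a; b; c; d].
  rewrite /= !inE !negb_or ac bd (diff a b) // (diff a d) // (diff c d) //.
  by rewrite eq_sym (diff c b).
have facetE F : (F \in facets D) =
    [|| (F == [set a; b]) && ([set a; b] \in facets D),
        (F == [set b; c]) && ([set b; c] \in facets D),
        (F == [set c; d]) && ([set c; d] \in facets D) |
        (F == [set d; a]) && ([set d; a] \in facets D)].
  apply/idP/idP => [FD|/or4P[]/andP[/eqP->]//].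
  have [u [v [uU vU eF]]] := bip F FD; move: FD; rewrite {}eF.
  move: uU vU; rewrite inU ninU.
  by move=> /orP[]/eqP-> /orP[]/eqP->;
    rewrite 1?[[set c; b]]setUC 1?[[set a; d]]setUC => ->; rewrite eqxx ?orbT.
have incU x :
    x \in U -> ([set x; b] \in facets D) || ([set x; d] \in facets D).
  move=> xU; have [F FD] := vertex_in_facet hD x.
  have [u [v [uU vU eF]]] := bip F FD; move: FD; rewrite {}eF => FD.
  rewrite in_set2 => /orP[]/eqP exv; last by rewrite exv (negPf vU) in xU.
  by move: vU; rewrite exv ninU => /orP[]/eqP<-; rewrite FD ?orbT.
have incV y :
    y \notin U -> ([set a; y] \in facets D) || ([set c; y] \in facets D).
  move=> yU; have [F FD] := vertex_in_facet hD y.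
  have [u [v [uU vU eF]]] := bip F FD; move: FD; rewrite {}eF => FD.
  rewrite in_set2 => /orP[]/eqP eyu; first by rewrite eyu uU in yU.
  by move: uU; rewrite eyu inU => /orP[]/eqP<-; rewrite FD ?orbT.
have rotu (x y z t : 'I_n) : uniq [:: x; y; z; t] -> uniq [:: y; z; t; x].
  by rewrite -[[:: y; z; t; x]]/(rot 1 [:: x; y; z; t]) rot_uniq.
have u1 := rotu _ _ _ _ uniq4.
have u2 := rotu _ _ _ _ u1.
have u3 := rotu _ _ _ _ u2.
(* With one edge missing, the others form a path from one end of it to the
   other. *)
move: (incU a aU) (incV b bU) (incU c cU) (incV d dU) facetE.
rewrite [[set a; d]]setUC [[set c; b]]setUC.
case: ([set a; b] \in _); case: ([set b; c] \in _);
  case: ([set c; d] \in _); case: ([set d; a] \in _) => //= _ _ _ _ facetE;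
  [ right; left; exists a, b, c, d | left; exists a, b, c, d
  | left; exists d, a, b, c | left; exists c, d, a, b
  | right; right; exists a, b, c, d | left; exists b, c, d, a
  | right; right; exists b, c, d, a ];
  split=> //; apply/setP=> F; rewrite facetE !inE;
  by move: (F == [set a; b]) (F == [set b; c]) (F == [set c; d])
    (F == [set d; a]) => [] [] [] [].
Qed.

(** The remaining weight after two 1-covers of weight at least 2 is zero, so
    both have 0/1 entries and the support of the first is a colour class. *)
Lemma all_ones_split_bipartite n (D : {set {set 'I_n}}) :
    n = 4 ->
    (forall b, is_cover D 1 b -> 2 <= mdeg b) ->
    (forall F, F \in facets D -> #|F| = 2) ->
    splits D 2 [multinom 1 | _ < n] ->
  exists U : {set 'I_n}, [/\ #|U| = 2, #|~: U| = 2 & bicolored D U].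
Proof.
move=> n4 weight cardF [c0 [s [size_s Cs]]].
case: s size_s Cs => [|b1 [|b2 [|? ?]]] // _ Cs; rewrite big_cons big_seq1 => E.
have C1 : is_cover D 1 b1 by apply: Cs; rewrite !inE eqxx.
have C2 : is_cover D 1 b2 by apply: Cs; rewrite !inE eqxx orbT.
have := mdeg_all_ones n; rewrite E !mdegD => degE.
have [w1 w2] := (weight _ C1, weight _ C2).
have Ei i : c0 i + (b1 i + b2 i) = 1 by rewrite -!mnmDE -E mnmE.
pose U := [set i | 0 < b1 i].
have cardU : #|U| = mdeg b1.
  rewrite mdegE -sum1_card big_mkcond /=; apply: eq_bigr => i _.
  by rewrite inE; have := Ei i; case: ltnP; lia.
have cardU2 : #|U| = 2 by rewrite cardU; lia.
exists U; split=> //.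
  by move: (cardsC U); rewrite cardU2 card_ord; move: #|_|; lia.
have hit (b : 'X_{1..n}) F : is_cover D 1 b -> F \in facets D ->
    exists2 i, i \in F & 0 < b i.
  move=> Cb FD; apply/exists_inP; have := Cb F FD; apply: contraTT.
  rewrite negb_exists_in => /forall_inP b0; rewrite -leqNgt leqn0 sum_nat_eq0.
  by apply/forall_inP => i /b0; lia.
move=> F FD; have [u uF bu] := hit _ _ C1 FD; have [v vF bv] := hit _ _ C2 FD.
have uU : u \in U by rewrite inE.
have vU : v \notin U by rewrite inE; have := Ei v; lia.
exists u, v; split=> //; apply/esym/eqP; rewrite eqEcard subUset !sub1set uF vF.
by rewrite cardF // cards2 (contraNneq _ vU) // => <-.
Qed.

Theorem corollary3p6 (k : fieldType) (n : nat) (hn : 4 <= n)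
    (D : {set {set 'I_n}})
    (hD : simplicial_complex D)
    (hpure : pure_of_dim D (n - 3))
    (hcone : ~ exists i : 'I_n, forall F : {set 'I_n},
        F \in facets D -> i \in F) :
  vertex_cover_standard_graded k D <->
  n = 4 /\ (is_path4 D \/ is_cycle4 D \/ is_two_disjoint_edges D).
Proof.
rewrite standard_gradedP; split=> [split_cover|[_ shape]].
  have cardF F : F \in facets D -> #|F| = n - 2 by move/hpure->; lia.
  have weight b : is_cover D 1 b -> 2 <= mdeg b.
    by apply: cover1_weight => //; lia.
  have S := split_cover _ _ (all_ones_cover cardF).
  have n4 : n = 4.
    have [c0 [s [sz Cs E]]] := S.
    have := split_weight c0 (fun b bs => weight b (Cs b bs)).
    by rewrite -E mdeg_all_ones sz; lia.
  split=> //; have n2 : n - 2 = 2 by lia.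
  rewrite n2 in S cardF.
  have [U [cardU cardUC bip]] := all_ones_split_bipartite n4 weight cardF S.
  exact: (two_colored_four_vertices (U := U)).
by case: shape => [|[]] [a [b [c [d [uniq4 eF]]]]];
  apply: (sub_cycle4_splits uniq4) => F; rewrite eF !inE;
  move: (F == [set a; b]) (F == [set b; c]) (F == [set c; d])
    (F == [set d; a]) => [] [] [] [].
Qed.
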